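(* Let $S$ be a semilattice-ordered semigroup. The join-radical closure operator $\sqrt[\lor]{-}:\mathcal{P}(S)\to\mathcal{P}(S)$ is algebraic.
   Context: A semilattice-ordered semigroup is a triple $(S,\cdot,\lor)$ with $S$ nonempty, $(S,\cdot)$ a semigroup, $(S,\lor)$ a semilattice (commutative, associative, idempotent), and $x(y\lor z)=xy\lor xz$, $(x\lor y)z=xz\lor yz$ for all $x,y,z\in S$. $\mathcal{P}(S)$ is the power set of $S$ and $\mathcal{P}_{\mathrm{fin}}(A)$ is the set of finite subsets of $A$. For $x\in S$ and a positive integer $n$, $x^{(n)}=x\lor x^2\lor\ldots\lor x^n$. For $A\subseteq S$, $\sqrt[\lor]{A}=\{x\in S\mid\exists n\in\mathbb{N}_+\text{ such that }x^{(n)}\in A\}$, where $\mathbb{N}_+$ is the set of positive integers; $A\mapsto\sqrt[\lor]{A}$ is a closure operator on $S$ (extensive, idempotent, order-preserving), called the join-radical closure. A closure operator $\mathrm{cl}$ on $S$, written $A\mapsto A^{\mathrm{cl}}$, is algebraic if $A^{\mathrm{cl}}=\bigcup\{F^{\mathrm{cl}}\mid F\in\mathcal{P}_{\mathrm{fin}}(A)\}$ for every $A\subseteq S$. *)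

(* Defs.v *)
From HB Require Import structures.
From mathcomp Require Import all_boot all_order.
From mathcomp Require Import boolp classical_sets functions cardinality.
From mathcomp Require Import zify.

Set Implicit Arguments.
Unset Strict Implicit.
Unset Printing Implicit Defensive.

Import Order.TTheory.
Local Open Scope classical_set_scope.
Local Open Scope order_scope.
Local Open Scope group_scope.

(* The semilattice (S, \/) is a joinSemilatticeType: its order is determined
   by the join, x <= y being x `|` y = y (leEjoin). *)
HB.mixin Record isSemilatticeOrderedSemigroup d S
    of Order.JoinSemilattice d S & Semigroup S := {
  sos_nonempty : inhabited S;
  mulgUr : forall x y z : S, x * (y `|` z)%O = ((x * y) `|` (x * z))%O;
  mulgUl : forall x y z : S, (x `|` y)%O * z = ((x * z) `|` (y * z))%O
}.

#[short(type="semilatticeOrderedSemigroupType")]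
HB.structure Definition SemilatticeOrderedSemigroup d :=
  { S of isSemilatticeOrderedSemigroup d S & Order.JoinSemilattice d S
       & Semigroup S }.

Record closure_operator (T : Type) := ClosureOperator {
  closure_fun :> set T -> set T;
  closure_extensive : forall A, A `<=` closure_fun A;
  closure_monotone : forall A B, A `<=` B -> closure_fun A `<=` closure_fun B;
  closure_idempotent : forall A, closure_fun (closure_fun A) = closure_fun A
}.

Definition algebraic_closure (T : Type) (cl : closure_operator T) : Prop :=
  forall A : set T,
    cl A = \bigcup_(F in [set F : set T | finite_set F /\ F `<=` A]) cl F.

Section JoinRadical.
Context {d : Order.disp_t} {S : semilatticeOrderedSemigroupType d}.
Implicit Types (x y z w : S) (A B : set S) (m n i j k : nat).

(* A semigroup has no unit, so the value at n = 0 is the junk value x. *)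
Definition spow x n : S := iterop n mul x x.

(* x^(n) = x \/ x^2 \/ ... \/ x^n for n >= 1; the value at n = 0 is junk. *)
Fixpoint join_pow x n : S :=
  match n with
  | 0 | 1 => x
  | m.+1 => (join_pow x m `|` spow x n)%O
  end.

Definition join_radical A : set S :=
  [set x | exists n, (0 < n)%N /\ A (join_pow x n)].

Lemma spowSS x n : spow x n.+2 = x * spow x n.+1.
Proof. by []. Qed.

Lemma spowD x m n : (0 < m)%N -> (0 < n)%N ->
  spow x (m + n) = spow x m * spow x n.
Proof.
case: m n => // m [//|n] _ _; elim: m => [|m IHm]; first by rewrite add1n.
by rewrite [(_ + _)%N]addSn [(m.+1 + _)%N]addSn spowSS -addSn IHm mulgA.
Qed.

Lemma join_powSS x n : join_pow x n.+2 = (join_pow x n.+1 `|` spow x n.+2)%O.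
Proof. by []. Qed.

Lemma spow_le_join_pow x n k : (0 < k <= n)%N ->
  (spow x k <= join_pow x n)%O.
Proof.
case: n => [|n]; first by case: k.
elim: n => [|n IHn] /andP[k_gt0]; first by case: k k_gt0 => [|[|]].
rewrite leq_eqVlt => /orP[/eqP->|lekn]; first by rewrite join_powSS leUr.
by rewrite join_powSS (le_trans (IHn _)) ?leUl // k_gt0.
Qed.

Lemma join_pow_le x n z : (0 < n)%N ->
    (forall k, (0 < k <= n)%N -> (spow x k <= z)%O) ->
  (join_pow x n <= z)%O.
Proof.
case: n => // n _; elim: n => [|n IHn] le_z; first exact: (le_z 1%N).
rewrite join_powSS leUx IHn ?le_z ?leqnn // => k /andP[k0 kn].
by rewrite le_z // k0 leqW.
Qed.

Lemma sos_le_mul x y z w : (x <= y)%O -> (z <= w)%O -> (x * z <= y * w)%O.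
Proof.
move=> xy zw; apply: (@le_trans _ _ (x * w)).
  by rewrite leEjoin -mulgUr (join_r zw).
by rewrite leEjoin -mulgUl (join_r xy).
Qed.

Lemma join_pow_mul_le x n y z : (0 < n)%N ->
    (forall k, (0 < k <= n)%N -> (spow x k * y <= z)%O) ->
  (join_pow x n * y <= z)%O.
Proof.
case: n => // n _; elim: n => [|n IHn] le_z; first exact: (le_z 1%N).
rewrite join_powSS mulgUl leUx IHn ?le_z ?leqnn // => k /andP[k0 kn].
by rewrite le_z // k0 leqW.
Qed.

Lemma mul_join_pow_le x n y z : (0 < n)%N ->
    (forall k, (0 < k <= n)%N -> (y * spow x k <= z)%O) ->
  (y * join_pow x n <= z)%O.
Proof.
case: n => // n _; elim: n => [|n IHn] le_z; first exact: (le_z 1%N).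
rewrite join_powSS mulgUr leUx IHn ?le_z ?leqnn // => k /andP[k0 kn].
by rewrite le_z // k0 leqW.
Qed.

Lemma spow_join_pow_le x n k :
  (spow (join_pow x n.+1) k.+1 <= join_pow x (k.+1 * n.+1))%O.
Proof.
elim: k => [|k IHk]; first by rewrite mul1n.
rewrite spowSS; apply: (le_trans (sos_le_mul (lexx _) IHk)).
apply: join_pow_mul_le => // i /andP[i0 lei].
apply: mul_join_pow_le => // j /andP[j0 lej].
rewrite -spowD //; apply: spow_le_join_pow; rewrite addn_gt0 i0 /=.
by rewrite mulSn leq_add.
Qed.

Lemma spow_le_spow_join_pow x n k i : (k.+1 <= i <= k.+1 * n.+1)%N ->
  (spow x i <= spow (join_pow x n.+1) k.+1)%O.
Proof.
elim: k i => [|k IHk] i /andP[ki ikn].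
  by apply: spow_le_join_pow; rewrite ki -[n.+1]mul1n.
have kn : (k.+1 <= k.+1 * n.+1)%N by rewrite leq_pmulr.
rewrite mulSn in ikn.
have [b /and3P[b0 bn /andP[bi kib]]] :
    exists b, [&& (0 < b), (b <= n.+1), (b < i)
                & (k.+1 <= i - b <= k.+1 * n.+1)]%N.
  by exists (maxn 1 (i - k.+1 * n.+1)); move: ki ikn kn; clear; lia.
rewrite -(subnKC (ltnW bi)) spowD // ?subn_gt0 // spowSS.
by apply: sos_le_mul (IHk _ kib); apply: spow_le_join_pow; rewrite b0.
Qed.

Lemma join_powM x m n : (0 < m)%N -> (0 < n)%N ->
  join_pow (join_pow x n) m = join_pow x (m * n).
Proof.
case: m n => // m [//|n] _ _; apply/eqP; rewrite eq_le; apply/andP; split.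
  apply: join_pow_le => // -[//|k] /andP[_ km].
  apply: le_trans (spow_join_pow_le _ _ _) _.
  apply: join_pow_le => // i /andP[i0 ik].
  by apply: spow_le_join_pow; rewrite i0 (leq_trans ik) // leq_mul2r km orbT.
apply: join_pow_le => // i /andP[i0 im].
have [k [km /andP[ki ik]]] :
    exists k, (k <= m)%N /\ (k.+1 <= i <= k.+1 * n.+1)%N.
  exists (i.-1 %/ n.+1); split; first by rewrite -ltnS ltn_divLR // prednK.
  have := leq_div i.-1 n.+1; have := @ltn_ceil i.-1 n.+1 isT.
  by lia.
apply: (le_trans (@spow_le_spow_join_pow x n k i _)); first by rewrite ki.
exact: spow_le_join_pow.
Qed.

Lemma join_radical_extensive A : A `<=` join_radical A.
Proof. by move=> x Ax; exists 1%N. Qed.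

Lemma join_radical_monotone A B :
  A `<=` B -> join_radical A `<=` join_radical B.
Proof. by move=> AB x [n [n0 An]]; exists n; split=> //; exact: AB. Qed.

Lemma join_radical_idempotent A :
  join_radical (join_radical A) = join_radical A.
Proof.
apply/seteqP; split=> [x [n [n0 [m [m0 Amn]]]]|]; last first.
  exact: join_radical_extensive.
by exists (m * n)%N; rewrite muln_gt0 m0 n0 -join_powM.
Qed.

End JoinRadical.

Definition join_radical_closure (d : Order.disp_t)
    (S : semilatticeOrderedSemigroupType d) : closure_operator S :=
  ClosureOperator (@join_radical_extensive d S) (@join_radical_monotone d S)
    (@join_radical_idempotent d S).

(* Main.v *)
Require Import Defs.
From mathcomp Require Import all_boot all_order.
From mathcomp Require Import classical_sets cardinality.

(** Membership of [x] in the join-radical of [A] is witnessed by a single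
    element of [A], namely some [join_pow x n]; the singleton of that element is
    therefore a finite subset of [A] whose join-radical already contains [x].
    The reverse inclusion is monotonicity. *)

Theorem proposition5p8 (d : Order.disp_t)
    (S : semilatticeOrderedSemigroupType d) :
  algebraic_closure (join_radical_closure S).
Proof.
move=> A; apply/seteqP; split=> [x [n [n_gt0 Axn]] | x [F [_ FA]]].
  exists [set join_pow x n]%classic; last by exists n.
  by split=> [|_ ->]; first exact: finite_set1.
exact: closure_monotone.
Qed.
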